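(* Let $d\ge 2$ and $n\ge 1$ be integers, let $\mathcal{I}=\{1,\dots,n\}^d$, and for $i=(i_1,\dots,i_d)\in\mathcal{I}$ let $$I_i^n=\left[\tfrac{i_1-1}{n},\tfrac{i_1}{n}\right)\times\cdots\times\left[\tfrac{i_d-1}{n},\tfrac{i_d}{n}\right).$$ Let $f:[0,1]^d\to\mathbb{R}$ be constant on each cube $I_i^n$, with $f(x)=a_i$ for all $x\in I_i^n$, $i\in\mathcal{I}$. Let $(x_i^* )_{i\in\mathcal{I}}$ be an optimal solution of the relaxed $d$-dimensional assignment problem with objective function $(a_i)_{i\in\mathcal{I}}$, and let $\mu^*$ be the measure on $[0,1]^d$ which, for each $i\in\mathcal{I}$, distributes mass $\frac1n x_i^*$ uniformly in the cube $I_i^n$. Then $\mu^*$ is a $d$-fold stochastic measure, and the $d$-copula $C^{\min}$ corresponding to $\mu^*$ satisfies $$\int_{[0,1]^d} f(x)\,dC^{\min}(x)=\min_{C\in\mathcal{C}^d}\int_{[0,1]^d} f(x)\,dC(x).$$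
   Context: A function $C:[0,1]^d\to[0,1]$ is a $d$-copula if there is a random vector $(U_1,\dots,U_d)$, each $U_k$ uniformly distributed on $[0,1]$, with $C(u_1,\dots,u_d)=\mathbb{P}(U_1\le u_1,\dots,U_d\le u_d)$ for all $u_1,\dots,u_d\in[0,1]$. $\mathcal{C}^d$ denotes the set of all $d$-copulas. A probability measure $\mu$ on the Borel sets of $[0,1]^d$ is called $d$-fold stochastic if each of its $d$ one-dimensional marginals is Lebesgue measure on $[0,1]$. There is a one-to-one correspondence between $d$-copulas and $d$-fold stochastic measures: the copula corresponding to $\mu$ is $C(x_1,\dots,x_d)=\mu([0,x_1]\times\cdots\times[0,x_d])$. The integral $\int_{[0,1]^d} f\,dC$ means the integral of $f$ with respect to the $d$-fold stochastic measure $\mu_C$ corresponding to $C$. (The cubes $I_i^n$ cover $[0,1)^d$, whose complement in $[0,1]^d$ is a null set for every $d$-fold stochastic measure.) For $k\in\{1,\dots,d\}$ and $m\in\{1,\dots,n\}$ let $\mathcal{I}^k_m=\{(i_1,\dots,i_d)\in\mathcal{I}: i_k=m\}$. The relaxed (axial) $d$-dimensional assignment problem with objective function $(a_i)_{i\in\mathcal{I}}$ is the linear program: minimize $\sum_{i\in\mathcal{I}}a_i x_i$ over $x=(x_i)_{i\in\mathcal{I}}\in\mathbb{R}^{n^d}$ subject to $\sum_{i\in\mathcal{I}^k_m}x_i=1$ for all $m\in\{1,\dots,n\}$ and all $k\in\{1,\dots,d\}$, and $x_i\ge 0$ for all $i\in\mathcal{I}$. *)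

(* Defs.v *)
From HB Require Import structures.
From mathcomp Require Import all_boot all_order all_algebra.
From mathcomp Require Import all_classical all_reals all_analysis.
From mathcomp Require Import measurable_realfun.

Set Implicit Arguments.
Unset Strict Implicit.
Unset Printing Implicit Defensive.
Import Order.TTheory GRing.Theory Num.Theory.
Import numFieldNormedType.Exports.
Local Open Scope classical_set_scope.
Local Open Scope ring_scope.

(* Points of R^d are d-tuples with the product sigma-algebra. A measure on the
   Borel sets of [0,1]^d is represented by a measure on R^d that gives no mass
   to the complement of [0,1]^d, and a function on [0,1]^d by a function on R^d
   of which only the values on [0,1]^d matter. The index set {1,...,n} is 'I_n,
   so that i_k corresponds to (tnth i k).+1. *)

Section boxes.
Context {R : realType} {d : nat}.

Definition unit_cube : set (d.-tuple R) :=
  [set y | forall k, 0 <= tnth y k <= 1].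

Definition lower_box (u : d.-tuple R) : set (d.-tuple R) :=
  [set y | forall k, 0 <= tnth y k <= tnth u k].

Definition cube (n : nat) (i : d.-tuple 'I_n) : set (d.-tuple R) :=
  [set y | forall k,
    (tnth i k)%:R / n%:R <= tnth y k < (tnth i k).+1%:R / n%:R].

Lemma measurable_tnth_itv (J : 'I_d -> interval R) :
  measurable [set y : d.-tuple R | forall k, tnth y k \in J k].
Proof.
rewrite (_ : [set _ | _] = \bigcap_(k in [set: 'I_d])
  ((fun y : d.-tuple R => tnth y k) @^-1` [set` J k])); last first.
  by apply/seteqP; split => y h => [k _|k]; [exact: h|exact: (h k I)].
apply: fin_bigcap_measurable => // k _; rewrite -[X in measurable X]setTI.
by apply: measurable_tnth => //; exact: measurable_itv.
Qed.

Lemma measurable_unit_cube : measurable unit_cube.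
Proof.
rewrite (_ : unit_cube = [set y | forall k, tnth y k \in `[0, 1]]).
  exact: measurable_tnth_itv.
by apply/seteqP; split => y /= h k; have := h k; rewrite in_itv.
Qed.

Lemma measurable_lower_box u : measurable (lower_box u).
Proof.
rewrite (_ : lower_box u = [set y | forall k, tnth y k \in `[0, tnth u k]]).
  exact: (@measurable_tnth_itv (fun k => `[0, tnth u k])).
by apply/seteqP; split => y /= h k; have := h k; rewrite in_itv.
Qed.

Lemma measurable_cube n (i : d.-tuple 'I_n) : measurable (cube i).
Proof.
rewrite (_ : cube i = [set y | forall k, tnth y k \in
   `[((tnth i k)%:R / n%:R), ((tnth i k).+1%:R / n%:R)[ ]).
  exact: (@measurable_tnth_itv
    (fun k => `[((tnth i k)%:R / n%:R), ((tnth i k).+1%:R / n%:R)[)).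
by apply/seteqP; split => y /= h k; have := h k; rewrite in_itv.
Qed.

End boxes.

Section lebesgue_unit_cube.
Context {R : realType}.

Definition tcons d (p : measurableTypeR R * d.-tuple R) : d.+1.-tuple R :=
  [the d.+1.-tuple R of p.1 :: p.2].

Lemma measurable_tcons d : measurable_fun setT (@tcons d).
Proof. exact: (@measurable_cons _ _ _ R fst _ snd). Qed.

HB.instance Definition _ d :=
  isMeasurableFun.Build _ _ _ _ (@tcons d) (@measurable_tcons d).

(* d-dimensional Lebesgue measure on [0,1]^d, as the d-fold product of Lebesgue
   measure on [0,1], which is uniform_prob ltr01 by uniform_prob01E below. *)
Fixpoint lebesgue_unit_cube d : probability (d.-tuple R) R :=
  match d with
  | 0 => dirac ([tuple] : 0.-tuple R)
  | d'.+1 => distribution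
      (uniform_prob (@ltr01 R) \x lebesgue_unit_cube d')%E (@tcons d')
  end.

End lebesgue_unit_cube.

Section copulas.
Context {R : realType} {d : nat}.
Implicit Types (C : d.-tuple R -> R) (f : d.-tuple R -> R).
Implicit Type mu : {measure set (d.-tuple R) -> \bar R}.

(* Laws are compared on measurable sets only: a measure of the library is a
   function on all sets, unspecified on the non-measurable ones. *)
Definition is_copula C := exists dO (O : measurableType dO)
    (P : probability O R) (U : 'I_d -> {RV P >-> R}),
  (forall k A, measurable A ->
     distribution P (U k) A = uniform_prob (@ltr01 R) A) /\
  (forall u, unit_cube u ->
     P [set w | forall k, U k w <= tnth u k] = (C u)%:E).

Definition d_fold_stochastic mu :=
  [/\ mu setT = 1%E, mu unit_cube = 1%E &
   forall (k : 'I_d) (A : set R), measurable A ->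
     pushforward mu (fun y => tnth y k) A =
     lebesgue_measure (A `&` `[0, 1])].

Definition corresponds mu C := d_fold_stochastic mu /\
  (forall u, unit_cube u -> mu (lower_box u) = (C u)%:E).

Definition copula_of mu : d.-tuple R -> R := fun u => fine (mu (lower_box u)).

(* The measure mu_C; copula_measureP and corresponds_unique below show that it
   exists and is unique (as a function on measurable sets). *)
Definition copula_measure C : probability (d.-tuple R) R :=
  get [set mu : probability (d.-tuple R) R | corresponds mu C].

(* The Lebesgue integral of the library is defined for every function, as the
   difference of the lower integrals of the positive and negative parts, hence
   it does not depend on f on measurable null sets, even where f is not
   measurable. *)
Definition copula_integral f C : \bar R :=
  (\int[copula_measure C]_(y in unit_cube) (f y)%:E)%E.

Lemma uniform_prob01E A : measurable A ->
  uniform_prob (@ltr01 R) A = lebesgue_measure (A `&` `[0, 1]).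
Proof.
move=> mA; rewrite /uniform_prob integral_uniform_pdf.
rewrite (eq_integral (fun=> 1%E)); last first.
  move=> x; rewrite inE/= in_itv/= => -[_ x01].
  by rewrite /uniform_pdf x01 subr0 invr1.
by rewrite integral_cst ?mul1e//; exact: measurableI.
Qed.

Lemma exists_corresponds C : is_copula C ->
  exists mu : probability (d.-tuple R) R, corresponds mu C.
Proof.
move=> [dO [Om [P [U [unifU UC]]]]].
pose V w : d.-tuple R := [tuple U k w | k < d].
have mV : measurable_fun setT V.
  apply/measurable_fun_tnthP => k.
  rewrite (_ : _ \o _ = U k); first exact: measurable_funPT.
  by apply/funext => w; rewrite /= tnth_mktuple.
pose X : {mfun Om >-> d.-tuple R} := HB.pack V
  (isMeasurableFun.Build _ _ _ _ V mV).
exists (distribution P X).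
have marg k A : measurable A -> P (U k @^-1` A) = lebesgue_measure (A `&` `[0, 1]).
  by move=> mA; rewrite -uniform_prob01E// -(unifU k).
have mU k (A : set R) : measurable A -> measurable (U k @^-1` A).
  by move=> mA; rewrite -[X in measurable X]setTI; exact: measurable_funPT.
have leb01 : lebesgue_measure (`[0, 1] : set R) = 1%E.
  by rewrite lebesgue_measure_itv/= lte_fin ltr01 oppr0 adde0.
pose N := \bigcup_(k in [set: 'I_d]) (U k @^-1` (~` `[0, 1])).
have mN : measurable N.
  by apply: fin_bigcup_measurable => // k _; apply: mU; exact: measurableC.
have N0 : P N = 0%E.
  have -> : N = \big[setU/set0]_(k : 'I_d) (U k @^-1` (~` `[0, 1])).
    apply/seteqP; split => w; rewrite -bigcup_seq/= => [] [k _ h]; exists k => //=.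
    by rewrite mem_index_enum.
  suff : forall r, measurable (\big[setU/set0]_(k <- r) (U k @^-1` (~` `[0, 1]))) /\
      P (\big[setU/set0]_(k <- r) (U k @^-1` (~` `[0, 1]))) = 0%E.
    by move=> /(_ (index_enum _))[].
  move=> r; elim/big_ind : _ => [|A B [mA A0] [mB B0]|k _].
  - by rewrite measure0.
  - by split; [exact: measurableU|rewrite measureU0].
  - split; first by apply: mU; exact: measurableC.
    by rewrite marg ?setICl ?measure0//; exact: measurableC.
have PN A : measurable A -> P (A `&` ~` N) = P A.
  move=> mA; have mAN : measurable (A `&` ~` N).
    by apply: measurableI => //; exact: measurableC.
  rewrite (@measureDI _ _ _ P A N)// setDE (@subset_measure0 _ _ _ P (A `&` N) N) ?adde0//.
  exact: measurableI.
have VN w : (~` N) w -> forall k, 0 <= U k w <= 1.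
  move=> Nw k; apply: contrapT => h; apply: Nw; exists k => [//|].
  by apply: contra_not h; rewrite /= in_itv.
split; first split.
- exact: probability_setT.
- change (P (V @^-1` unit_cube) = 1%E); rewrite -PN; last first.
    by rewrite -[X in measurable X]setTI; exact: (mV measurableT _ measurable_unit_cube).
  rewrite (_ : _ `&` _ = setT `&` ~` N) ?PN ?probability_setT//.
  apply/seteqP; split => w /= [h Nw]; split => // k.
  by rewrite tnth_mktuple; exact: VN.
- move=> k A mA; rewrite -(marg k)//.
  change (P (V @^-1` ((fun y : d.-tuple R => tnth y k) @^-1` A)) = P (U k @^-1` A)).
  by congr (P _); apply/seteqP; split => w /=; rewrite tnth_mktuple.
- move=> u u01; rewrite -UC//.
  change (P (V @^-1` lower_box u) = P [set w | forall k, U k w <= tnth u k]).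
  have mW : measurable [set w | forall k, U k w <= tnth u k].
    rewrite (_ : [set _ | _] = \bigcap_(k in [set: 'I_d])
      (U k @^-1` `]-oo, tnth u k])); last first.
      by apply/seteqP; split => w /= h k; have := h k; rewrite /= in_itv//=; exact.
    by apply: fin_bigcap_measurable => // k _; exact: mU.
  rewrite -PN; last first.
    by rewrite -[X in measurable X]setTI; exact: (mV measurableT _ (measurable_lower_box u)).
  rewrite -[RHS]PN//; congr (P _); apply/seteqP; split => w /= [h Nw]; split => // k.
  + by have := h k; rewrite tnth_mktuple => /andP[].
  + by rewrite tnth_mktuple h andbT; have /andP[] := VN _ Nw k.
Qed.

Lemma tuple_bounded (y : d.-tuple R) :
  exists m : nat, forall k, tnth y k <= m%:R.
Proof.
exists (\max_(k < d) Num.bound `|tnth y k|%R)%N => k.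
apply: (le_trans (ler_norm _)); apply/ltW; apply: (lt_le_trans (archi_boundP _)) => //.
by rewrite ler_nat (leq_bigmax k).
Qed.

Lemma measurable_tuple_orthantE : @measurable _ (d.-tuple R) =
  <<s [set A | exists u : d.-tuple R, A = [set y | forall k, tnth y k <= tnth u k]] >>.
Proof.
set G := (X in <<s X >>).
apply/seteqP; split; last first.
  apply: smallest_sub; first exact: sigma_algebra_measurable.
  move=> _ [u ->].
  rewrite (_ : [set y | _] = [set y | forall k, tnth y k \in `]-oo, tnth u k]]).
    exact: (@measurable_tnth_itv _ _ (fun k => `]-oo, tnth u k])).
  by apply/seteqP; split => y /= h k; have := h k; rewrite in_itv.
apply: smallest_sub; first exact: smallest_sigma_algebra.
move=> A; rewrite -bigcup_seq => [] [k _ [B mB <-]].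
have {}mB : (@RGenOInfty.G R).-sigma.-measurable B.
  by rewrite -RGenOInfty.measurableE.
move: B mB.
rewrite -/(_ `<=` [set B | <<s G >> (setT `&` (fun y : d.-tuple R => tnth y k) @^-1` B)]).
apply: smallest_sub.
  exact: (@sigma_algebra_image _ _ setT (fun y : d.-tuple R => tnth y k) <<s G >>
    (smallest_sigma_algebra _ _)).
move=> _ [x ->] /=; rewrite setTI.
rewrite -setCitvl preimage_setC; apply: sigma_algebraC.
pose u (m : nat) : d.-tuple R := [tuple if j == k then x else m%:R | j < d].
rewrite [X in <<s _ >> X](_ : _ =
    \bigcup_m [set y : d.-tuple R | forall j, tnth y j <= tnth (u m) j]).
  by apply: sigma_algebra_bigcup => m; apply: sub_sigma_algebra; exists (u m).
apply/seteqP; split => y /=.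
  rewrite in_itv/= => yx; have [m ym] := tuple_bounded y; exists m => // j.
  by rewrite tnth_mktuple; case: eqP => [->|].
by move=> [m _ /(_ k)]; rewrite tnth_mktuple eqxx in_itv.
Qed.

(* mu_C is unique: two measures corresponding to C agree on measurable sets. *)
Lemma corresponds_unique (mu nu : {measure set (d.-tuple R) -> \bar R}) C :
  corresponds mu C -> corresponds nu C ->
  forall A, measurable A -> mu A = nu A.
Proof.
have key (m : {measure set (d.-tuple R) -> \bar R}) (u : d.-tuple R) :
    m setT = 1%E -> m unit_cube = 1%E ->
    m [set y | forall k, tnth y k <= tnth u k] =
    if `[< forall k, 0 <= tnth u k >] then
      m (lower_box [tuple Num.min (tnth u k) 1 | k < d]) else 0%E.
  move=> mT m1.
  set B := [set y | _].
  have mB : measurable B.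
    rewrite (_ : B = [set y | forall k, tnth y k \in `]-oo, tnth u k]]).
      exact: (@measurable_tnth_itv _ _ (fun k => `]-oo, tnth u k])).
    by apply/seteqP; split => y /= h k; have := h k; rewrite in_itv.
  have mc := @measurable_unit_cube R d.
  have mC0 : m (~` unit_cube) = 0%E.
    have mTfin : (m setT < +oo)%E by rewrite mT ltry.
    have -> : m (~` unit_cube) = (m setT - m unit_cube)%E.
      by rewrite -setTD measureD// setTI.
    by rewrite mT m1 subee.
  rewrite (@measureDI _ _ _ m B unit_cube)// (@subset_measure0 _ _ _ m _ (~` unit_cube))//.
  - rewrite add0e; case: asboolP => h.
      congr (m _); apply/seteqP; split => y /=.
        move=> [yB yc] k; rewrite tnth_mktuple le_min yB.
        by have /andP[-> ->] := yc k.
      move=> yh; split => k; have := yh k; rewrite tnth_mktuple le_min => /and3P[]// y0 y1 y2.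
      by rewrite y0.
    rewrite (_ : _ `&` _ = set0) ?measure0// -subset0 => y [yB yc]; apply: h => k.
    by have /andP[y0 _] := yc k; exact: (le_trans y0 (yB k)).
  - exact: measurableD.
  - exact: measurableC.
move=> [[muT mu1 _] muC] [[nuT nu1 _] nuC].
pose g (j : nat) : set (d.-tuple R) :=
  [set y | forall k, tnth y k <= tnth [tuple j%:R | _ < d] k].
apply: (measure_unique _ g measurable_tuple_orthantE).
- move=> _ _ [u ->] [v ->].
  exists [tuple Num.min (tnth u k) (tnth v k) | k < d].
  apply/seteqP; split => y /=.
    by move=> [yu yv] k; rewrite tnth_mktuple le_min yu yv.
  move=> h; split => k; have := h k; rewrite tnth_mktuple le_min => /andP[]//.
- by move=> j; exists [tuple j%:R | _ < d].
- rewrite -subTset => y _; have [m ym] := tuple_bounded y.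
  by exists m => // k; rewrite tnth_mktuple.
- move=> _ [u ->]; rewrite !key//; case: asboolP => // h.
  by rewrite muC ?nuC// => k; rewrite tnth_mktuple le_min h ler01 ge_min lexx orbT.
- move=> j; apply: (@le_lt_trans _ _ (mu setT)); last by rewrite muT ltry.
  apply: le_measure => //; rewrite inE//.
  by rewrite measurable_tuple_orthantE; apply: sub_sigma_algebra; exists [tuple j%:R | _ < d].
Qed.

Lemma copula_measureP C : is_copula C -> corresponds (copula_measure C) C.
Proof. by move=> /exists_corresponds h; exact: getPex h. Qed.

End copulas.

Section assignment.
Context {R : realType} {d n : nat}.
Implicit Types (a x y : d.-tuple 'I_n -> R).

Definition feasible_assignment x :=
  (forall (m : 'I_n) (k : 'I_d),
     \sum_(i : d.-tuple 'I_n | tnth i k == m) x i = 1) /\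
  (forall i, 0 <= x i).

Definition assignment_cost a x := \sum_(i : d.-tuple 'I_n) a i * x i.

Definition optimal_assignment a x := feasible_assignment x /\
  (forall y, feasible_assignment y ->
     assignment_cost a x <= assignment_cost a y).

Lemma optimal_assignment_ge0 a x : optimal_assignment a x -> forall i, 0 <= x i.
Proof. by case => -[]. Qed.

End assignment.

Section assignment_measure.
Context {R : realType} {d n : nat}.
Variable x : d.-tuple 'I_n -> R.
Hypothesis x_ge0 : forall i, 0 <= x i.
Local Notation lebesgue := (@lebesgue_unit_cube R d).

(* The uniform distribution on a cube Q is
   A |-> lebesgue (A `&` Q) / lebesgue Q. The argument x_ge0 is what makes this
   set function a measure. *)
Definition assignment_measure (_ : forall i, 0 <= x i) (A : set (d.-tuple R)) :=
  (\sum_(i : d.-tuple 'I_n) (x i / n%:R)%:E *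
     ((fine (lebesgue (cube i)))^-1%:E * lebesgue (A `&` cube i)))%E.

Local Notation mu := (assignment_measure x_ge0).

Let mu0 : mu set0 = 0%E.
Proof.
by rewrite /mu big1// => i _; rewrite set0I measure0 !mule0.
Qed.

Let mu_ge0 A : (0 <= mu A)%E.
Proof.
by apply: sume_ge0 => i _; rewrite !mule_ge0// lee_fin ?divr_ge0// invr_ge0 fine_ge0.
Qed.

Let mu_sigma_additive : semi_sigma_additive mu.
Proof.
move=> F mF tF mUF; rewrite [X in _ --> X](_ : _ =
    lim ((fun n => \sum_(0 <= i < n) mu (F i))%E @ \oo)).
  by apply: is_cvg_ereal_nneg_natsum => k _; exact: mu_ge0.
rewrite nneseries_sum//; last first.
  by move=> i j _; rewrite !mule_ge0// lee_fin ?divr_ge0// invr_ge0 fine_ge0.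
apply: eq_bigr => /= i _.
rewrite nneseriesZl//; last first.
  by move=> j _; rewrite !mule_ge0// lee_fin invr_ge0 fine_ge0.
rewrite nneseriesZl//; congr (_ * (_ * _))%E.
exact: (measure_semi_bigcup (mrestr lebesgue (measurable_cube i))).
Qed.

HB.instance Definition _ := isMeasure.Build _ _ _ mu mu0 mu_ge0 mu_sigma_additive.

End assignment_measure.

(* Main.v *)
(* Only the masses m_i of the cubes matter: the cubes cover [0,1]^d up to a null
   set of any d-fold stochastic measure, so the integral of f is the sum of the
   a_i m_i. The slab of points whose k-th coordinate lies in the m-th cell has
   mass 1/n by the marginal condition, hence (n m_i) is feasible for the
   assignment problem and the integral is its cost divided by n. For mu* one
   gets m_i = x*_i / n, so the integral is the optimal cost divided by n. *)
Require Import Defs.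
From HB Require Import structures.
From mathcomp Require Import all_boot all_order all_algebra.
From mathcomp Require Import all_classical all_reals all_analysis.
From mathcomp Require Import measurable_realfun ring.

Set Implicit Arguments.
Unset Strict Implicit.
Unset Printing Implicit Defensive.
Import Order.TTheory GRing.Theory Num.Theory.
Local Open Scope classical_set_scope.
Local Open Scope ring_scope.
Import HBNNSimple.

(** * Conull sets and finite disjoint unions *)

Section conull.
Context d (T : measurableType d) (R : realType).
Variable mu : {measure set T -> \bar R}.
Local Open Scope ereal_scope.

Lemma measureI_conull (A E : set T) : measurable A -> measurable E ->
  mu (~` E) = 0 -> mu (A `&` E) = mu A.
Proof.
move=> mA mE E0; rewrite [RHS](@measureDI _ _ _ mu A E)// setDE.
rewrite (@subset_measure0 _ _ _ mu (A `&` ~` E) (~` E)) ?add0e//.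
- by apply: measurableI => //; exact: measurableC.
- exact: measurableC.
Qed.

(** As [f] need not be measurable, the argument goes through the integral as a supremum over simple
    functions: cutting a simple function down to [E] leaves its integral unchanged. *)
Let ge0_integral_setI_conull (D E : set T) (f : T -> \bar R) :
  measurable E -> mu (~` E) = 0 -> (forall x, 0 <= f x) ->
  \int[mu]_(x in D `&` E) f x = \int[mu]_(x in D) f x.
Proof.
move=> mE E0 f0; rewrite !ge0_integralE//.
have fDE x : (f \_ (D `&` E)) x = if x \in E then (f \_ D) x else 0.
  by rewrite /patch in_setI andbC; case: (x \in E); case: (x \in D).
apply/eqP; rewrite eq_le; apply/andP; split; apply: ge_ereal_sup => _ [h/= hf <-].
  apply: ereal_sup_ubound; exists h => // x; apply: (le_trans (hf x)).
  by rewrite fDE; case: ifP => // _; apply: erestrict_ge0.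
(* For the converse inequality the witness is [h] times the indicator of [E]; it lies below [f] on
   [D]&[E] and vanishes off [E]. *)
apply: ereal_sup_ubound; exists (proj_nnsfun h mE).
  move=> x; rewrite fDE (_ : proj_nnsfun h mE x = h x * \1_E x)%R// indicE.
  by case: (x \in E); rewrite ?mulr1 ?mulr0//; exact: hf.
(* The level set at 0 also picks up the complement of [E], but its term is 0. For [r] nonzero the
   level set is that of [h] intersected with [E], of the same measure. *)
apply: eq_fsbigr => r _; have [->|r0] := eqVneq r 0%R; first by rewrite !mul0e.
congr (_ * _); rewrite -[RHS](measureI_conull _ mE E0)//; congr (mu _).
have projE x : proj_nnsfun h mE x = (h x * (x \in E)%:R)%R by rewrite -indicE.
apply/seteqP; split => x.
  move=> /(etrans (esym (projE x))); have [xE|_] := boolP (x \in E).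
    by rewrite mulr1 => hx; split => //; exact/set_mem.
  by rewrite mulr0 => r00; rewrite -r00 eqxx in r0.
by move=> [hx /mem_set xE]; apply: (etrans (projE x)); rewrite xE mulr1.
Qed.

(* The library's null-set lemmas ask for [f] to be measurable. *)
Lemma integral_setI_conull (D E : set T) (f : T -> \bar R) :
  measurable E -> mu (~` E) = 0 ->
  \int[mu]_(x in D `&` E) f x = \int[mu]_(x in D) f x.
Proof.
by move=> mE E0; rewrite integralE [RHS]integralE !ge0_integral_setI_conull.
Qed.

Lemma measure_bigcup_fintype (I : finType) (P : pred I) (F : I -> set T) :
  (forall i, measurable (F i)) -> trivIset setT F ->
  mu (\bigcup_(i in [set i | P i]) F i) = \sum_(i | P i) mu (F i).
Proof.
move=> mF tF; rewrite measure_fin_bigcup//; [|exact: finite_finset|exact: sub_trivIset tF].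
rewrite (fsbigE (enum P)) ?enum_uniq//=; last 2 first.
  by move=> i /=; rewrite mem_enum.
  by move=> i /= Pi; rewrite mem_enum => /negP[].
rewrite big_enum_cond; apply: eq_bigl => i.
by apply/andP/idP => [[]//|Pi]; split=> //; exact: mem_set.
Qed.

End conull.

(** * Boxes under Lebesgue measure on the unit cube *)

Lemma preimage_tcons_box (R : realType) d (B : 'I_d.+1 -> set R) :
  @tcons R d @^-1` [set y | forall k, B k (tnth y k)] =
  B ord0 `*` [set y | forall k, B (lift ord0 k) (tnth y k)].
Proof.
apply/seteqP; split => -[r y] /=.
  move=> h; split => [|k]; first exact: (h ord0).
  by have := h (lift ord0 k); rewrite tnthS.
move=> [/= B0 Bk] k.
case: (unliftP ord0 k) => [j ->|-> //].
by rewrite tnthS.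
Qed.

Lemma measurable_box (R : realType) d (B : 'I_d -> set R) :
  (forall k, measurable (B k)) ->
  measurable [set y : d.-tuple R | forall k, B k (tnth y k)].
Proof.
move=> mB.
rewrite (_ : [set _ | _] = \bigcap_(k in [set: 'I_d])
  ((fun y : d.-tuple R => tnth y k) @^-1` B k)); last first.
  by apply/seteqP; split => y h => [k _|k]; [exact: h|exact: (h k I)].
apply: fin_bigcap_measurable => // k _; rewrite -[X in measurable X]setTI.
exact: measurable_tnth.
Qed.

(** Induction on [d]: the measure is the image under [tcons] of a product measure, and the preimage
    of a box under [tcons] is a rectangle whose second side is a box of one dimension less. *)
Lemma lebesgue_unit_cube_box (R : realType) d (B : 'I_d -> set R) :
  (forall k, measurable (B k)) ->
  lebesgue_unit_cube d [set y | forall k, B k (tnth y k)] =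
  (\prod_(k < d) lebesgue_measure (B k `&` `[0%R, 1%R]))%E.
Proof.
elim: d B => [|d IH] B mB.
  by rewrite big_ord0 /= diracE mem_set// => -[].
rewrite big_ord_recl -(IH (fun k => B (lift ord0 k)))// -uniform_prob01E; last exact: mB.
transitivity ((uniform_prob (@ltr01 R) \x lebesgue_unit_cube d)%E
  (@tcons R d @^-1` [set y | forall k, B k (tnth y k)])); first by [].
rewrite preimage_tcons_box product_measure1E//; first exact: mB.
exact: (measurable_box (B := fun k => B (lift ord0 k))).
Qed.

(** * The grid of cells and cubes *)

Section cells.
Context {R : realType} {d n : nat}.
Hypothesis n_gt0 : (0 < n)%N.

Definition cell (m : nat) : set R := `[m%:R / n%:R, m.+1%:R / n%:R[.

Let n_gt0R : 0 < n%:R :> R. Proof. by rewrite ltr0n. Qed.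

(** With the denominator cleared, [m] is the integer part of [r * n%:R]; both uniqueness and
    existence of the cell containing a point come from this. *)
Lemma cellE m (r : R) : cell m r = (m%:R <= r * n%:R < m.+1%:R) :> Prop.
Proof. by rewrite /cell /= in_itv/= ler_pdivrMr// ltr_pdivlMr. Qed.

Lemma cell_inj (r : R) m1 m2 : cell m1 r -> cell m2 r -> m1 = m2.
Proof. by rewrite !cellE => /truncn_def <- /truncn_def <-. Qed.

Lemma itv01_cell (r : R) : 0 <= r < 1 -> exists m : 'I_n, cell m r.
Proof.
move=> /andP[r0 r1]; have rn0 : 0 <= r * n%:R by rewrite mulr_ge0// ltW.
have /andP[mr rm] := truncn_itv rn0.
have mn : (Num.truncn (r * n%:R) < n)%N.
  by rewrite -(ltr_nat R) (le_lt_trans mr)// gtr_pMl.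
by exists (Ordinal mn); rewrite cellE mr.
Qed.

Lemma cell_itv01 (m : 'I_n) (r : R) : cell m r -> 0 <= r < 1.
Proof.
rewrite /cell /= in_itv/= => /andP[mr rm]; apply/andP; split.
  by apply: le_trans mr; rewrite divr_ge0.
by apply: (lt_le_trans rm); rewrite ler_pdivrMr// mul1r ler_nat.
Qed.

Lemma lebesgue_cell m : lebesgue_measure (cell m) = (n%:R^-1)%:E.
Proof.
rewrite /cell lebesgue_measure_itv/= lte_fin ltr_pM2r ?invr_gt0// ltr_nat ltnSn.
by rewrite -EFinB -mulrBl -natrB// subSnn mul1r.
Qed.

Lemma cubeE (i : d.-tuple 'I_n) :
  cube i = [set y : d.-tuple R | forall k, cell (tnth i k) (tnth y k)].
Proof. by apply/seteqP; split => y h k; have := h k; rewrite /cell /= in_itv. Qed.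

Lemma trivIset_cube : trivIset setT (@cube R d n).
Proof.
move=> i j _ _ [y []]; rewrite !cubeE => yi yj; apply/eq_from_tnth => k.
by apply/val_inj; exact: (cell_inj (yi k) (yj k)).
Qed.

Lemma bigcup_cubeE :
  \bigcup_(i : d.-tuple 'I_n) cube i = [set y : d.-tuple R | forall k, 0 <= tnth y k < 1].
Proof.
apply/seteqP; split => [y [i _]|y y01].
  by rewrite cubeE => yi k; exact: cell_itv01 (yi k).
have [i yi] := choice (fun k => itv01_cell (y01 k)).
by exists [tuple i k | k < d] => //; rewrite cubeE => k; rewrite tnth_mktuple.
Qed.

Lemma measurable_bigcup_cube : measurable (\bigcup_i @cube R d n i).
Proof. by apply: fin_bigcup_measurable => // i _; exact: measurable_cube. Qed.

Lemma cube_sub_unit_cube (i : d.-tuple 'I_n) : @cube R d n i `<=` unit_cube.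
Proof.
by rewrite cubeE => y yi k; have /andP[-> /ltW] := cell_itv01 (yi k).
Qed.

(** The intersection with all cubes is needed because the slab leaves the coordinates other than [k]
    unrestricted. *)
Lemma bigcup_slab (k : 'I_d) (j : 'I_n) :
  (fun y : d.-tuple R => tnth y k) @^-1` cell j `&` \bigcup_(i : d.-tuple 'I_n) cube i =
  \bigcup_(i in [set i : d.-tuple 'I_n | tnth i k == j]) cube i.
Proof.
apply/seteqP; split => [y [/= yj [i _ yi]]|y [i /= /eqP ij yi]].
  exists i => //=; apply/eqP/val_inj; move: yi; rewrite cubeE => /(_ k) yi.
  exact: cell_inj yi yj.
by split; [move: yi; rewrite -ij cubeE => /(_ k)|exists i].
Qed.

(** * Cube masses of a stochastic measure *)

Section stochastic.
Variable mu : {measure set (d.-tuple R) -> \bar R}.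
Hypothesis mu_stoch : d_fold_stochastic mu.

(** A point missed by every cube has some coordinate outside [[0, 1[]. By the marginal condition
    this has, for each coordinate, the Lebesgue measure of the single point 1. *)
Lemma stochastic_bigcup_cubeC : mu (~` \bigcup_(i : d.-tuple 'I_n) cube i) = 0%E.
Proof.
have [_ _ marg] := mu_stoch.
pose N (k : 'I_d) : set (d.-tuple R) := (fun y => tnth y k) @^-1` ~` `[0, 1[.
have mN k : measurable (N k).
  rewrite -[X in measurable X]setTI; apply: measurable_tnth => //.
  exact: measurableC.
rewrite bigcup_cubeE.
apply/eqP; rewrite eq_le measure_ge0 andbT.
(* Writing 0 as the sum of the null masses [mu (N k)] lets finite subadditivity conclude. *)
have -> : 0%E = (\sum_(k \in [set: 'I_d]) mu (N k))%E.
  rewrite fsbig1// => k _; apply: (etrans (marg k _ _)); first exact: measurableC.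
  rewrite (_ : _ `&` _ = [set 1]) ?lebesgue_measure_set1//.
  apply/seteqP; split => [r [r01]|r ->]; last first.
    by split; rewrite /= in_itv/= ?ltxx ?andbF// ler01 lexx.
  rewrite /= in_itv/= => /andP[r0 r1]; apply/eqP; rewrite eq_le r1 leNgt.
  by apply/negP => r1'; apply: r01; rewrite /= in_itv/= r0.
apply: content_sub_fsum => //.
  exact: finite_finset.
  by apply: measurableC; rewrite -bigcup_cubeE; exact: measurable_bigcup_cube.
by move=> y /existsNP[k yk]; exists k => //; rewrite /N/= in_itv.
Qed.

(** Up to the null complement of the cubes, the sum is the mass of a slab, and the marginal
    condition turns that into the length of a cell. *)
Lemma stochastic_slab_sum (k : 'I_d) (j : 'I_n) :
  (\sum_(i : d.-tuple 'I_n | tnth i k == j) mu (cube i) = (n%:R^-1)%:E)%E.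
Proof.
have [_ _ marg] := mu_stoch.
have mcell : measurable (cell j) by exact: measurable_itv.
rewrite -measure_bigcup_fintype; [|exact: measurable_cube|exact: trivIset_cube].
rewrite -bigcup_slab measureI_conull; last 3 first.
- by rewrite -[X in measurable X]setTI; exact: measurable_tnth.
- exact: measurable_bigcup_cube.
- exact: stochastic_bigcup_cubeC.
apply: (etrans (marg k _ mcell)).
rewrite setIidl ?lebesgue_cell// => r /cell_itv01/andP[r0 r1].
by rewrite /= in_itv/= r0 ltW.
Qed.

Lemma stochastic_fin_num A : measurable A -> mu A \is a fin_num.
Proof.
have [muT _ _] := mu_stoch; move=> mA; rewrite ge0_fin_numE//.
by apply: (@le_lt_trans _ _ (mu setT)); [rewrite le_measure ?inE|rewrite muT ltry].
Qed.

Definition cube_mass (i : d.-tuple 'I_n) : R := n%:R * fine (mu (cube i)).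

Lemma cube_mass_feasible : feasible_assignment cube_mass.
Proof.
split => [j k|i]; last by rewrite mulr_ge0// fine_ge0.
rewrite -mulr_sumr; have := stochastic_slab_sum k j.
rewrite (eq_bigr (fun i => (fine (mu (cube i)))%:E)); last first.
  by move=> i _; rewrite fineK// stochastic_fin_num//; exact: measurable_cube.
by rewrite sumEFin => -[->]; rewrite divff// gt_eqF.
Qed.

Lemma integral_cubewise_constant (a : d.-tuple 'I_n -> R) (f : d.-tuple R -> R) :
  (forall i y, cube i y -> f y = a i) ->
  (\int[mu]_(y in unit_cube) (f y)%:E =
   (assignment_cost a cube_mass / n%:R)%:E)%E.
Proof.
move=> fa; rewrite -(integral_setI_conull _ _ measurable_bigcup_cube) ?stochastic_bigcup_cubeC//.
rewrite setIidr; last by move=> y [i _]; exact: cube_sub_unit_cube.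
have UE : \bigcup_(i : d.-tuple 'I_n) cube i = \big[setU/set0]_(i : d.-tuple 'I_n) @cube R d n i.
  rewrite -bigcup_seq; apply: eq_bigcupl; split => i //= _.
  exact: mem_index_enum.
(* On the union of the cubes [f] coincides with a combination of indicators. This supplies the
   measurability needed to split the integral over the cubes. *)
have faE y (i : d.-tuple 'I_n) : cube i y -> f y = \sum_(j : d.-tuple 'I_n) a j * \1_(cube j) y.
  move=> yi; rewrite (bigD1 i)//= big1 ?addr0 => [|j ji].
    by rewrite indicE mem_set// mulr1; exact: fa.
  rewrite indicE memNset ?mulr0// => yj; move/eqP: ji; apply.
  by apply: trivIset_cube => //; exists y.
rewrite UE integral_bigsetU_EFin//=; last 4 first.
- exact: measurable_cube.
- exact: index_enum_uniq.
- by apply: sub_trivIset trivIset_cube.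
- rewrite -UE; apply/measurable_EFinP.
  apply: (eq_measurable_fun (fun y => \sum_(j : d.-tuple 'I_n) a j * \1_(cube j) y)).
    by move=> y /set_mem[i _ /faE ->].
  apply: measurable_sum => j; apply: measurable_funM => //.
  by apply: measurable_indic; exact: measurable_cube.
rewrite /assignment_cost mulr_suml -sumEFin; apply: eq_bigr => i _.
rewrite (eq_integral (cst (a i)%:E)) => [|y /set_mem /fa -> //].
rewrite integral_cst; last exact: measurable_cube.
(* The factor [n%:R] in [cube_mass] cancels the division by [n%:R]. *)
rewrite /cube_mass mulrCA mulrC mulKf ?gt_eqF// EFinM fineK//.
by rewrite stochastic_fin_num//; exact: measurable_cube.
Qed.
End stochastic.
End cells.

(** * The copula of a stochastic measure *)

Section copula_of_stochastic.
Context {R : realType} {d : nat}.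
Variable mu : {measure set (d.-tuple R) -> \bar R}.
Hypothesis mu_stoch : d_fold_stochastic mu.

Lemma corresponds_copula_of : corresponds mu (copula_of mu).
Proof.
split=> // u _; rewrite /copula_of fineK//.
by apply: stochastic_fin_num => //; exact: measurable_lower_box.
Qed.

(** The random vector is given by the coordinate projections on the space of [d]-tuples with law
    [mu]. *)
Lemma is_copula_copula_of : is_copula (copula_of mu).
Proof.
have [muT mu1 marg] := mu_stoch.
(* Normalization makes a bundled probability out of [mu]; as the total mass is 1, it changes no
   value, and the second argument is only the fallback for a total mass of 0 or infinity. *)
pose P : probability (d.-tuple R) R := mnormalize mu (lebesgue_unit_cube d).
have PE A : P A = mu A.
  by rewrite /P/= /mnormalize muT onee_eq0/= invr1 mule1.
have mcoord k : measurable_fun [set: d.-tuple R] (fun y => tnth y k).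
  exact: measurable_tnth.
pose U (k : 'I_d) : {RV P >-> R} := HB.pack (fun y : d.-tuple R => tnth y k)
  (isMeasurableFun.Build _ _ _ _ (fun y : d.-tuple R => tnth y k) (mcoord k)).
have mC0 : mu (~` unit_cube) = 0%E.
  by rewrite -PE probability_setC ?PE ?mu1 ?subee//; exact: measurable_unit_cube.
exists _, (d.-tuple R), P, U; split => [k A mA|u u01].
  by rewrite uniform_prob01E// -(marg k)//; exact: PE.
have [_ <-//] := corresponds_copula_of.
have mB : measurable [set y : d.-tuple R | forall k, tnth y k <= tnth u k].
  rewrite (_ : [set _ | _] = [set y | forall k, tnth y k \in `]-oo, tnth u k]]).
    exact: (@measurable_tnth_itv _ _ (fun k => `]-oo, tnth u k])).
  by apply/seteqP; split => y /= h k; have := h k; rewrite in_itv.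
transitivity (mu [set y | forall k, tnth y k <= tnth u k]); first exact: PE.
(* Intersecting with the unit cube supplies the lower bounds 0 that [lower_box] asks for. *)
rewrite -(measureI_conull mB measurable_unit_cube)//; congr (mu _).
apply/seteqP; split => [y [yu y01] k|y yu]; first by have /andP[-> _] := y01 k; exact: yu.
split => k; have /andP[y0 yuk] := yu k => //.
by rewrite y0 (le_trans yuk)//; have /andP[] := u01 k.
Qed.

End copula_of_stochastic.

(** * The measure built from a feasible assignment *)

Section assignment_measure_stochastic.
Context {R : realType} {d n : nat}.
Hypothesis n_gt0 : (0 < n)%N.
Variable x : d.-tuple 'I_n -> R.
Hypothesis x_ge0 : forall i, 0 <= x i.
Local Notation lebesgue := (@lebesgue_unit_cube R d).
Local Notation cell := (@cell R n).
Local Notation mu := (assignment_measure x_ge0).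

Let n_neq0 : n%:R != 0 :> R. Proof. by rewrite pnatr_eq0 -lt0n. Qed.

Let cell_setI01 (A : set R) (m : 'I_n) : A `&` cell m `&` `[0, 1] = A `&` cell m.
Proof.
apply/setIidl => r [_ /(cell_itv01 n_gt0)/andP[r0 r1]].
by rewrite /= in_itv/= r0 ltW.
Qed.

Let mcell m : measurable (cell m). Proof. exact: measurable_itv. Qed.

Lemma lebesgue_cube (i : d.-tuple 'I_n) : lebesgue (cube i) = (n%:R^-1 ^+ d)%:E.
Proof.
rewrite cubeE (lebesgue_unit_cube_box (B := fun k => cell (tnth i k)))//.
under eq_bigr do rewrite -[X in X `&` _]setTI cell_setI01 setTI lebesgue_cell//.
by rewrite prodEFin prodr_const card_ord.
Qed.

(** Cutting by the slab affects only the [k]-th side of the cube: its length, the inverse of [n], is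
    replaced by the measure of [A] within the cell. *)
Lemma lebesgue_cube_slab (k : 'I_d) (A : set R) (i : d.-tuple 'I_n) :
  measurable A ->
  lebesgue ((fun y => tnth y k) @^-1` A `&` cube i) =
  (n%:R%:E * lebesgue_measure (A `&` cell (tnth i k)) * lebesgue (cube i))%E.
Proof.
(* Taking [S] to be [A] gives the cut cube and [setT] gives the whole cube, so one product formula
   serves both sides. *)
move=> mA; pose B (S : set R) l := (if l == k then S else setT) `&` cell (tnth i l).
have BE S : (fun y : d.-tuple R => tnth y k) @^-1` S `&` cube i =
    [set y | forall l, B S l (tnth y l)].
  rewrite cubeE /B; apply/seteqP; split => [y [yS yi] l|y yB].
    by split; [case: eqP => // ->|exact: yi].
  by split => [|l]; [have := yB k; rewrite eqxx => -[]|have [] := yB l].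
have mB S l : measurable S -> measurable (B S l).
  by move=> mS; apply: measurableI => //; case: ifP.
have lebB S : measurable S -> lebesgue [set y | forall l, B S l (tnth y l)] =
    (lebesgue_measure (S `&` cell (tnth i k)) *
     \prod_(l | l != k) lebesgue_measure (cell (tnth i l)))%E.
  move=> mS; rewrite lebesgue_unit_cube_box; last by move=> l; exact: mB.
  rewrite (bigD1 k)//= /B eqxx cell_setI01; congr (_ * _)%E.
  by apply: eq_bigr => l /negbTE ->; rewrite cell_setI01 setTI.
rewrite BE lebB// -[cube i]setTI -[X in X `&` cube i](preimage_setT (fun y => tnth y k)).
by rewrite BE lebB// setTI lebesgue_cell// muleACA -EFinM divff// mul1e.
Qed.

(** The factor [n%:R] from [lebesgue_cube_slab] cancels the [n%:R] dividing the mass [x i], and the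
    volume of the cube cancels its inverse. *)
Lemma assignment_measure_slab (k : 'I_d) (A : set R) : measurable A ->
  mu ((fun y => tnth y k) @^-1` A) =
  (\sum_(i : d.-tuple 'I_n)
     (x i)%:E * lebesgue_measure (A `&` cell (tnth i k)))%E.
Proof.
move=> mA; apply: eq_bigr => i _.
rewrite lebesgue_cube_slab// lebesgue_cube/= muleAC !muleA -!EFinM.
congr (_%:E * _)%E; field.
by rewrite n_neq0 expf_neq0 ?invr_neq0.
Qed.

Lemma assignment_measure_cube (i : d.-tuple 'I_n) : mu (cube i) = (x i / n%:R)%:E.
Proof.
rewrite /assignment_measure (bigD1 i)//= big1 ?adde0 => [|j ji].
  rewrite setIid lebesgue_cube/= -EFinM mulVf ?mule1//; first by rewrite mulr1.
  by rewrite expf_neq0// invr_neq0.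
rewrite (_ : cube i `&` cube j = set0) ?measure0 ?mule0//.
apply/eqP/negPn/negP => /set0P h; move/eqP: ji; apply; apply/esym.
exact: (trivIset_cube n_gt0 I I h).
Qed.

(** The cells are disjoint and cover [[0, 1]] except for the null point 1. *)
Lemma lebesgue_itv01_cells (A : set R) : measurable A ->
  lebesgue_measure (A `&` `[0, 1]) =
  (\sum_(j : 'I_n) lebesgue_measure (A `&` cell j))%E.
Proof.
move=> mA.
rewrite -(@measure_bigcup_fintype _ _ _ lebesgue_measure _ xpredT); last 2 first.
- by move=> j; apply: measurableI; [exact: mA|exact: mcell].
- move=> j1 j2 _ _ [r [[_ r1] [_ r2]]]; apply/val_inj.
  exact: (cell_inj n_gt0 r1 r2).
rewrite -(@measureI_conull _ _ _ lebesgue_measure (A `&` `[0, 1]) (~` [set 1])).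
- congr lebesgue_measure; apply/seteqP; split => r.
    move=> [[Ar]]; rewrite /= in_itv/= => /andP[r0 r1] r1'.
    have [|j rj] := @itv01_cell _ _ n_gt0 r; last by exists j.
    by rewrite r0 lt_neqAle r1 andbT; apply/eqP.
  move=> [j _ [Ar /(cell_itv01 n_gt0)/andP[r0 r1]]].
  split; first by split => //; rewrite /= in_itv/= r0 ltW.
  by move=> /= r1'; rewrite r1' ltxx in r1.
- by apply: measurableI; [exact: mA|exact: measurable_itv].
- exact: measurableC.
- by rewrite setCK; exact: lebesgue_measure_set1.
Qed.

Hypothesis d_gt0 : (0 < d)%N.
Hypothesis x_feas : feasible_assignment x.

Lemma assignment_measure_stochastic : d_fold_stochastic mu.
Proof.
have marg (k : 'I_d) (A : set R) : measurable A ->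
    mu ((fun y => tnth y k) @^-1` A) = lebesgue_measure (A `&` `[0, 1]).
  move=> mA; rewrite assignment_measure_slab// lebesgue_itv01_cells//.
  (* Grouping the cubes by their [k]-th index [j], the assignment constraint makes the total
     coefficient of each cell [j] equal to 1. *)
  rewrite (partition_big (fun i => tnth i k) xpredT)//=; apply: eq_bigr => j _.
  rewrite (eq_bigr (fun i => (x i)%:E * lebesgue_measure (A `&` cell j))%E).
    rewrite -ge0_sume_distrl; last by move=> i _; rewrite lee_fin.
    by rewrite sumEFin; have [-> _] := x_feas; rewrite mul1e.
  by move=> i /eqP ->.
have muT : mu setT = 1%E.
  (* The total mass is read off the first marginal, which exists because [d] is positive. *)
  rewrite -(preimage_setT (fun y : d.-tuple R => tnth y (Ordinal d_gt0))) marg//.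
  by rewrite setTI lebesgue_measure_itv/= lte_fin ltr01 oppr0 adde0.
(* Every cube lies in the unit cube, so [unit_cube] and [setT] give the same sum term by term. *)
split => //; rewrite -muT /=; apply: eq_bigr => i _.
rewrite setTI (setIidr (cube_sub_unit_cube n_gt0 (i:=i)))//.
Qed.

End assignment_measure_stochastic.

(** * Comparison with an arbitrary copula *)

Theorem theorem3p1 (R : realType) (d n : nat) (hd : (2 <= d)%N) (hn : (1 <= n)%N)
    (a : d.-tuple 'I_n -> R) (f : d.-tuple R -> R)
    (hf : forall (i : d.-tuple 'I_n) (y : d.-tuple R), cube i y -> f y = a i)
    (x : d.-tuple 'I_n -> R) (hx : optimal_assignment a x) :
  let mu : {measure set (d.-tuple R) -> \bar R} :=
    assignment_measure (optimal_assignment_ge0 hx) in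
  let Cmin : d.-tuple R -> R := copula_of mu in
  d_fold_stochastic mu /\
  [/\ is_copula Cmin, corresponds mu Cmin &
      forall C : d.-tuple R -> R, is_copula C ->
        (copula_integral f Cmin <= copula_integral f C)%E].
Proof.
move=> mu Cmin; have [x_feas x_min] := hx.
have mu_stoch : d_fold_stochastic mu.
  by apply: assignment_measure_stochastic => //; exact: ltnW.
have Cmin_copula : is_copula Cmin := is_copula_copula_of mu_stoch.
have mu_Cmin : corresponds mu Cmin := corresponds_copula_of mu_stoch.
split=> //; split=> // C C_copula; rewrite /copula_integral.
have [C_stoch _] := copula_measureP C_copula.
(* [copula_measure Cmin] is obtained by choice, so it is identified with [mu] only on measurable
   sets, which is enough for the integral. *)
rewrite (eq_measure_integral mu) => [|A mA _]; last first.
  exact: corresponds_unique (copula_measureP Cmin_copula) mu_Cmin A mA.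
(* Both integrals become assignment costs divided by [n], so the claim reduces to the optimality of
   [x]. *)
rewrite !(@integral_cubewise_constant _ _ _ hn _ _ a)//.
rewrite lee_fin ler_pM2r ?invr_gt0 ?ltr0n//.
have -> : cube_mass mu = x.
  apply/funext => i; rewrite /cube_mass.
  have -> : mu (cube i) = (x i / n%:R)%:E by exact: assignment_measure_cube.
  by rewrite mulrC divfK// pnatr_eq0 -lt0n.
by apply: x_min; exact: cube_mass_feasible.
Qed.
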